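(* Let $G$ be a group, let $R$ be an $EM$-$G$-graded ring and let $S\subseteq h(R)$ be a multiplicatively closed subset of $R$. Then $S^{-1}R$ is an $EM$-$G$-graded ring with respect to the gradation $$(S^{-1}R)_\lambda=\left\{\tfrac{a}{s}\ \middle|\ s\in S,\ a\in h(R) \text{ such that } \lambda=(\deg(s))^{-1}\deg(a)\right\},\qquad \lambda\in G.$$
   Context: All rings are commutative with $1$. For a ring $A$, $Z(A)$ is the set of zero divisors of $A$ ($0$ included) and $reg(A)$ is the set of regular elements (non-zero-divisors). A ring $A$ is $G$-graded if $A=\oplus_{\sigma\in G}A_\sigma$ for additive subgroups $A_\sigma$ with $A_\sigma A_\tau\subseteq A_{\sigma\tau}$ for all $\sigma,\tau\in G$. The elements of $A_\sigma$ are homogeneous of degree $\sigma$ (written $\deg$), and $h(A)=\bigcup_{\sigma}A_\sigma$ is the set of homogeneous elements. If $A$ is $G$-graded, $A[x]$ is $G$-graded by $(A[x])_\sigma=A_\sigma[x]$; so a polynomial is homogeneous iff all its coefficients lie in a single $A_\sigma$. $A$ is an $EM$-$G$-graded ring if every nonzero homogeneous zero divisor polynomial $f\in A[x]$ has an annihilating content, i.e. there are $c_f\in Z(A)$ and $f_1\in reg(A[x])$ (neither required to be homogeneous) with $f=c_ff_1$. It is known that the displayed components define a $G$-gradation of $S^{-1}R$. *)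

(* Defs.v *)
From HB Require Import structures.
From mathcomp Require Import all_boot all_order all_algebra.
From mathcomp Require Import boolp classical_sets ring.

Set Implicit Arguments.
Unset Strict Implicit.
Unset Printing Implicit Defensive.

Import GRing.Theory.
Local Open Scope ring_scope.
Local Open Scope quotient_scope.

(* The localization S^-1 R, for S containing 1 and closed under products.
   S may contain zero divisors, and even 0, in which case S^-1 R is the zero
   ring; hence a comPzRingType instead of a comNzRingType. *)
Section Localization.
Variables (R : comPzRingType) (S : mulrClosed R).

Local Notation pair := (R * {s : R | s \in S})%type.
Implicit Types p q r : pair.

Definition loc_den p : R := val p.2.

Lemma loc_denP p : loc_den p \in S.
Proof. exact: valP p.2. Qed.

Definition loc_pair (a s : R) (Ss : s \in S) : pair := (a, exist _ s Ss).

Definition loc_rel p q : bool :=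
  `[< exists2 u, u \in S & u * (p.1 * loc_den q - q.1 * loc_den p) = 0 >].

Lemma loc_relP p q :
  reflect (exists2 u, u \in S & u * (p.1 * loc_den q) = u * (q.1 * loc_den p))
          (loc_rel p q).
Proof.
apply: (iffP (asboolP _)) => -[u Su e]; exists u => //.
  by apply/eqP; rewrite -subr_eq0 -mulrBr e.
by rewrite mulrBr e subrr.
Qed.

Lemma loc_rel_refl : reflexive loc_rel.
Proof. by move=> p; apply/loc_relP; exists 1; rewrite ?rpred1. Qed.

Lemma loc_rel_sym : symmetric loc_rel.
Proof. by move=> p q; apply/loc_relP/loc_relP => -[u Su e]; exists u. Qed.

Lemma loc_rel_trans : transitive loc_rel.
Proof.
move=> q p r /loc_relP[u Su e1] /loc_relP[v Sv e2]; apply/loc_relP.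
exists (u * v * loc_den q); first by rewrite !rpredM ?loc_denP.
transitivity (v * loc_den r * (u * (p.1 * loc_den q))); first by ring.
rewrite e1.
transitivity (u * loc_den p * (v * (q.1 * loc_den r))); first by ring.
by rewrite e2; ring.
Qed.

Canonical loc_rel_equiv :=
  EquivRel loc_rel loc_rel_refl loc_rel_sym loc_rel_trans.

Definition localization := {eq_quot loc_rel}.
HB.instance Definition _ : EqQuotient _ loc_rel localization :=
  EqQuotient.on localization.
HB.instance Definition _ := Choice.on localization.

(* [loc_frac a Ss] is the fraction a / s, where Ss : s \in S. *)
Definition loc_frac (a s : R) (Ss : s \in S) : localization :=
  \pi_localization (loc_pair a Ss).

Lemma loc_piP p q :
  reflect (exists2 u, u \in S & u * (p.1 * loc_den q) = u * (q.1 * loc_den p))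
          (p == q %[mod localization]).
Proof. by rewrite eqmodE; exact: loc_relP. Qed.

Lemma loc_reprP p :
  exists2 u, u \in S &
    u * ((repr (\pi_localization p)).1 * loc_den p)
      = u * (p.1 * loc_den (repr (\pi_localization p))).
Proof. by apply/loc_piP; rewrite reprK. Qed.

Definition loc_add_pair p q : pair :=
  loc_pair (p.1 * loc_den q + q.1 * loc_den p)
           (rpredM (loc_denP p) (loc_denP q)).
Definition loc_opp_pair p : pair := loc_pair (- p.1) (loc_denP p).
Definition loc_mul_pair p q : pair :=
  loc_pair (p.1 * q.1) (rpredM (loc_denP p) (loc_denP q)).

Definition loc_add := lift_op2 localization loc_add_pair.
Definition loc_opp := lift_op1 localization loc_opp_pair.
Definition loc_mul := lift_op2 localization loc_mul_pair.
Definition loc_zero : localization := loc_frac 0 (rpred1 S).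
Definition loc_one : localization := loc_frac 1 (rpred1 S).

Lemma loc_pi_add :
  {morph \pi_localization : p q / loc_add_pair p q >-> loc_add p q}.
Proof.
move=> p q; unlock loc_add; apply/eqP; rewrite eq_sym; apply/loc_piP.
have [u Su] := loc_reprP p; have [v Sv] := loc_reprP q.
set q' := repr _ => eq_q; set p' := repr _ => eq_p.
exists (u * v); first by rewrite rpredM.
rewrite /loc_add_pair /loc_den /= -!/(loc_den _).
transitivity (v * loc_den q * loc_den q' * (u * (p'.1 * loc_den p))
  + u * loc_den p * loc_den p' * (v * (q'.1 * loc_den q))); first by ring.
by rewrite eq_p eq_q; ring.
Qed.
Canonical loc_pi_add_morph := PiMorph2 loc_pi_add.

Lemma loc_pi_opp :
  {morph \pi_localization : p / loc_opp_pair p >-> loc_opp p}.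
Proof.
move=> p; unlock loc_opp; apply/eqP; rewrite eq_sym; apply/loc_piP.
have [u Su] := loc_reprP p; set p' := repr _ => eq_p.
exists u => //; rewrite /loc_opp_pair /loc_den /= -!/(loc_den _).
by rewrite !mulNr !mulrN eq_p.
Qed.
Canonical loc_pi_opp_morph := PiMorph1 loc_pi_opp.

Lemma loc_pi_mul :
  {morph \pi_localization : p q / loc_mul_pair p q >-> loc_mul p q}.
Proof.
move=> p q; unlock loc_mul; apply/eqP; rewrite eq_sym; apply/loc_piP.
have [u Su] := loc_reprP p; have [v Sv] := loc_reprP q.
set q' := repr _ => eq_q; set p' := repr _ => eq_p.
exists (u * v); first by rewrite rpredM.
rewrite /loc_mul_pair /loc_den /= -!/(loc_den _).
transitivity ((u * (p'.1 * loc_den p)) * (v * (q'.1 * loc_den q))).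
  by ring.
by rewrite eq_p eq_q; ring.
Qed.
Canonical loc_pi_mul_morph := PiMorph2 loc_pi_mul.

Lemma loc_pi_eq p q :
  p.1 * loc_den q = q.1 * loc_den p ->
  \pi_localization p = \pi_localization q.
Proof. by move=> e; apply/eqP/loc_piP; exists 1; rewrite ?rpred1 ?e. Qed.

Lemma loc_addA : associative loc_add.
Proof.
elim/quotW=> p; elim/quotW=> q; elim/quotW=> r; rewrite !piE.
apply: loc_pi_eq; rewrite /loc_add_pair /loc_den /=; ring.
Qed.

Lemma loc_addC : commutative loc_add.
Proof.
elim/quotW=> p; elim/quotW=> q; rewrite !piE.
apply: loc_pi_eq; rewrite /loc_add_pair /loc_den /=; ring.
Qed.

Lemma loc_add0 : left_id loc_zero loc_add.
Proof.
elim/quotW=> p; rewrite /loc_zero /loc_frac !piE.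
apply: loc_pi_eq; rewrite /loc_add_pair /loc_den /=; ring.
Qed.

Lemma loc_addN : left_inverse loc_zero loc_opp loc_add.
Proof.
elim/quotW=> p; rewrite /loc_zero /loc_frac !piE.
apply: loc_pi_eq; rewrite /loc_add_pair /loc_opp_pair /loc_den /=; ring.
Qed.

HB.instance Definition _ :=
  GRing.isZmodule.Build localization loc_addA loc_addC loc_add0 loc_addN.

Lemma loc_mulA : associative loc_mul.
Proof.
elim/quotW=> p; elim/quotW=> q; elim/quotW=> r; rewrite !piE.
apply: loc_pi_eq; rewrite /loc_mul_pair /loc_den /=; ring.
Qed.

Lemma loc_mulC : commutative loc_mul.
Proof.
elim/quotW=> p; elim/quotW=> q; rewrite !piE.
apply: loc_pi_eq; rewrite /loc_mul_pair /loc_den /=; ring.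
Qed.

Lemma loc_mul1 : left_id loc_one loc_mul.
Proof.
elim/quotW=> p; rewrite /loc_one /loc_frac !piE.
apply: loc_pi_eq; rewrite /loc_mul_pair /loc_den /=; ring.
Qed.

Lemma loc_mulDl : left_distributive loc_mul loc_add.
Proof.
elim/quotW=> p; elim/quotW=> q; elim/quotW=> r; rewrite !piE.
apply: loc_pi_eq; rewrite /loc_mul_pair /loc_add_pair /loc_den /=; ring.
Qed.

HB.instance Definition _ :=
  GRing.Zmodule_isComPzRing.Build localization
    loc_mulA loc_mulC loc_mul1 loc_mulDl.

Lemma loc_fracP (a s b t : R) (Ss : s \in S) (St : t \in S) :
  loc_frac a Ss = loc_frac b St <->
  exists2 u, u \in S & u * (a * t - b * s) = 0.
Proof.
split=> [/eqP/loc_piP[u Su e]|[u Su e]].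
  by exists u; rewrite // mulrBr [u * (a * t)]e subrr.
by apply/eqP/loc_piP; exists u; rewrite //; apply/eqP;
  rewrite -subr_eq0 -mulrBr; apply/eqP.
Qed.

Lemma loc_fracW (P : localization -> Prop) :
  (forall (a s : R) (Ss : s \in S), P (loc_frac a Ss)) -> forall x, P x.
Proof. by move=> H; elim/quotW => -[a [s Ss]]; exact: H. Qed.

Lemma loc_fracD (a s b t : R) (Ss : s \in S) (St : t \in S) :
  loc_frac a Ss + loc_frac b St
    = loc_frac (a * t + b * s) (rpredM Ss St).
Proof. by rewrite /loc_frac [LHS]piE; apply: loc_pi_eq. Qed.

Lemma loc_fracM (a s b t : R) (Ss : s \in S) (St : t \in S) :
  loc_frac a Ss * loc_frac b St = loc_frac (a * b) (rpredM Ss St).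
Proof. by rewrite /loc_frac [LHS]piE; apply: loc_pi_eq. Qed.

End Localization.

Arguments localization {R} S.
Arguments loc_frac {R} S a s Ss.

Section Graded.
Local Open Scope classical_set_scope.

(* A = \oplus_g A_ g as an internal direct sum of additive subgroups: every
   element is a finite sum of elements of distinct components, and such a sum
   vanishes only if all its terms do. *)
Record gradation (G : groupType) (A : pzRingType) (A_ : G -> set A) : Prop :=
  Gradation {
    gradation0 : forall g, A_ g 0;
    gradationB : forall g a b, A_ g a -> A_ g b -> A_ g (a - b);
    gradation_span : forall a, exists (s : seq G) (f : G -> A),
      [/\ uniq s, forall g, A_ g (f g) & a = \sum_(g <- s) f g];
    gradation_free : forall (s : seq G) (f : G -> A),
      uniq s -> (forall g, A_ g (f g)) -> \sum_(g <- s) f g = 0 ->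
      forall g, g \in s -> f g = 0;
    gradationM : forall g h a b, A_ g a -> A_ h b -> A_ (g * h)%g (a * b)
  }.

Definition homogeneous (G : groupType) (A : Type) (A_ : G -> set A) : set A :=
  \bigcup_g A_ g.

Definition poly_gradation (G : groupType) (A : nzRingType) (A_ : G -> set A)
    (g : G) : set {poly A} :=
  [set f | forall i, A_ g f`_i].

(* As 1 != 0 in a comNzRingType, 0 is a zero divisor. *)
Definition zero_divisor (A : comNzRingType) : set A :=
  [set a | exists2 b, b != 0 & a * b = 0].

Definition regular (A : comNzRingType) : set A := ~` @zero_divisor A.

Definition annihilating_content (A : comNzRingType) (f : {poly A}) : Prop :=
  exists (c : A) (f1 : {poly A}),
    [/\ zero_divisor c, regular f1 & f = c%:P * f1].

(* {poly A} requires A to be nontrivial; a nontrivial ring in comPzRingType is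
   seen as a comNzRingType through the alias [nontrivial A1]. *)
Definition nontrivial (A : comPzRingType) (A1 : (1 : A) != 0) : Type := A.
HB.instance Definition _ (A : comPzRingType) (A1 : (1 : A) != 0) :=
  GRing.ComPzRing.on (nontrivial A1).
HB.instance Definition _ (A : comPzRingType) (A1 : (1 : A) != 0) :=
  GRing.PzSemiRing_isNonZero.Build (nontrivial A1) A1.

(* The condition on polynomials is vacuous over the zero ring, which has no
   nonzero polynomial, so it is only imposed when 1 != 0. *)
Definition EM_graded (G : groupType) (A : comPzRingType) (A_ : G -> set A) :
    Prop :=
  gradation A_ /\
  forall (A1 : (1 : A) != 0) (f : {poly nontrivial A1}),
    f != 0 ->
    homogeneous (@poly_gradation G (nontrivial A1) A_) f ->
    zero_divisor f ->
    annihilating_content f.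

(* The elements a / s with s \in S, a homogeneous and
   g = (deg s)^-1 (deg a). The zero element is homogeneous of every degree. *)
Definition loc_gradation (G : groupType) (R : comPzRingType)
    (R_ : G -> set R) (S : mulrClosed R) (g : G) : set (localization S) :=
  [set x | exists (a s : R) (Ss : s \in S) (da ds : G),
     [/\ R_ da a, R_ ds s, g = (ds^-1 * da)%g & x = loc_frac S a s Ss]].

End Graded.

(* Main.v *)
(* A homogeneous polynomial f over S^-1 R is p / s with s in S and p homogeneous
   over R. If f h = 0 with h = k / t nonzero, then p (u k) = 0 for some u in S
   and u k != 0, so p is a zero divisor and p = c p1 with p1 regular. Clearing
   denominators in the same way shows that p1 stays regular over S^-1 R, and
   then c / s is an annihilating content of f: (c / s) h = 0 because p1 is
   regular, so any nonzero coefficient of h kills c / s. (The annihilator of c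
   itself may vanish in S^-1 R.) *)

Require Import Defs.
From HB Require Import structures.
From mathcomp Require Import all_boot all_order all_algebra.
From mathcomp Require Import boolp classical_sets.
From mathcomp Require Import ring.

Set Implicit Arguments.
Unset Strict Implicit.
Unset Printing Implicit Defensive.

Import GRing.Theory.
Local Open Scope ring_scope.

(** * Descent of annihilating contents along a localization map *)

Section LocalizationMorphism.
Variables (A B : comNzRingType) (S : mulrClosed A) (phi : {rmorphism A -> B}).
(** These three properties characterize [B] as the localization of [A] at [S], with [phi] as
    canonical map. *)
Hypothesis phi_unit : forall s, s \in S -> exists v, v * phi s = 1.
Hypothesis phi_frac :
  forall x : B, exists a s, s \in S /\ phi s * x = phi a.
Hypothesis phi_ker :
  forall a, phi a = 0 -> exists2 u, u \in S & u * a = 0.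

Local Notation "p ^phi" := (map_poly phi p) (at level 2, format "p ^phi").

Lemma poly_clear_den (h : {poly B}) :
  exists s k, s \in S /\ (phi s)%:P * h = k^phi.
Proof.
elim/poly_ind: h => [|h c [s [k [Ss e]]]].
  by exists 1, 0; rewrite rpred1 mulr0 rmorph0.
have [a [t [St et]]] := phi_frac c.
exists (s * t), (t%:P * k * 'X + (s * a)%:P); split; first exact: rpredM.
rewrite rmorphD /= !(rmorphM (map_poly phi)) /= map_polyX !map_polyC /= -e.
rewrite !(rmorphM phi) -et.
by rewrite !polyCM; ring.
Qed.

(** Each of the finitely many coefficients is killed by an element of [S]; the product of these
    elements kills them all. *)
Lemma poly_ker_den (k : {poly A}) :
  k^phi = 0 -> exists2 u, u \in S & u%:P * k = 0.
Proof.
elim/poly_ind: k => [_|k c IH]; first by exists 1; rewrite ?rpred1 ?mulr0.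
rewrite rmorphD /= rmorphM /= map_polyX map_polyC /= => e.
have /IH[u Su eu] : k^phi = 0.
  apply/polyP=> i; have /polyP/(_ i.+1) := e.
  by rewrite coefD coefMX coefC !coef0 /= addr0.
have /phi_ker[v Sv ev] : phi c = 0.
  by have /polyP/(_ 0%N) := e; rewrite coefD coefMX coefC coef0 /= add0r.
exists (u * v); first exact: rpredM.
transitivity (v%:P * (u%:P * k) * 'X + u%:P * (v * c)%:P).
  by rewrite !polyCM; ring.
by rewrite eu ev !(mulr0, mul0r, addr0).
Qed.

Lemma poly_unit_den s (h : {poly B}) :
  s \in S -> (phi s)%:P * h = 0 -> h = 0.
Proof.
move=> /phi_unit[v ev] e.
by rewrite -[h]mul1r -polyC1 -ev polyCM -mulrA e mulr0.
Qed.

(** Serves twice: directly, to find a zero divisor over [A], and by contraposition, to keep a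
    regular polynomial regular over [B]. *)
Lemma poly_ann_descent (p : {poly A}) (h : {poly B}) :
  h != 0 -> p^phi * h = 0 -> zero_divisor p.
Proof.
move=> h0 ph; have [t [k [St et]]] := poly_clear_den h.
have /poly_ker_den[u Su eu] : (p * k)^phi = 0.
  by rewrite rmorphM /= -et mulrCA ph mulr0.
exists (u%:P * k); last by rewrite mulrCA.
(* [phi u] and [phi t] are units, so [u k = 0] would force [h = 0]. *)
apply: contraNneq h0 => /(congr1 (map_poly phi)).
rewrite rmorphM /= map_polyC rmorph0 -et => /(poly_unit_den Su).
by move=> /(poly_unit_den St) ->.
Qed.

(** The EM condition enters as an implication about the single polynomial [g], which keeps degrees
    out of the argument. *)
Lemma annihilating_content_descent s (g : {poly A}) (f : {poly B}) :
  s \in S -> (phi s)%:P * f = g^phi -> f != 0 -> zero_divisor f ->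
  (g != 0 -> zero_divisor g -> annihilating_content g) ->
  annihilating_content f.
Proof.
move=> Ss e f0 [h h0 fh] EMg.
have [||c [g1 [_ reg_g1 eg]]] := EMg.
- apply: contraNneq f0 => g0; apply/eqP/(poly_unit_den Ss).
  by rewrite e g0 rmorph0.
- by apply: (poly_ann_descent h0); rewrite -e -mulrA fh mulr0.
have reg_phi : regular g1^phi.
  by move=> [k k0 ek]; apply: reg_g1; apply: poly_ann_descent ek.
(* [v] inverts [phi s], so [v * phi c] is the fraction [c / s]. *)
have [v ev] := phi_unit Ss.
have ef : f = (v * phi c)%:P * g1^phi.
  rewrite -[LHS]mul1r -polyC1 -ev !polyCM -!mulrA e eg rmorphM /=.
  by rewrite map_polyC.
exists (v * phi c), g1^phi; split=> //.
(* As [g1^phi] is regular, an annihilator of [f] annihilates its content. *)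
have ch : (v * phi c)%:P * h = 0.
  apply: contrapT => /eqP ch0; apply: reg_phi.
  exists ((v * phi c)%:P * h) => //.
  by rewrite mulrCA mulrA -ef.
exists (lead_coef h); first by rewrite lead_coef_eq0.
by rewrite lead_coefE -coefCM ch coef0.
Qed.

End LocalizationMorphism.

(** * Arithmetic of fractions *)

Section Fractions.
Variables (R : comPzRingType) (S : mulrClosed R).

Lemma loc_frac_eq (a s b t : R) (Ss : s \in S) (St : t \in S) :
  a * t = b * s -> loc_frac S a s Ss = loc_frac S b t St.
Proof.
by move=> e; apply/loc_fracP; exists 1; rewrite ?rpred1 // e subrr mulr0.
Qed.

Lemma loc_frac_eq0 (a s : R) (Ss : s \in S) :
  loc_frac S a s Ss = 0 <-> exists2 u, u \in S & u * a = 0.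
Proof.
split=> [/loc_fracP[u Su]|[u Su e]].
  by rewrite mul0r subr0 mulr1 => e; exists u.
by apply/loc_fracP; exists u; rewrite // mul0r subr0 mulr1.
Qed.

Lemma loc_frac0 (s : R) (Ss : s \in S) : loc_frac S 0 s Ss = 0.
Proof. by apply/loc_frac_eq0; exists s; rewrite ?mulr0. Qed.

Lemma loc_fracDl (a b s : R) (Ss : s \in S) :
  loc_frac S a s Ss + loc_frac S b s Ss = loc_frac S (a + b) s Ss.
Proof. by rewrite loc_fracD; apply: loc_frac_eq; ring. Qed.

Lemma loc_fracN (a s : R) (Ss : s \in S) :
  - loc_frac S a s Ss = loc_frac S (- a) s Ss.
Proof. by apply/eqP; rewrite eq_sym -addr_eq0 loc_fracDl addNr loc_frac0. Qed.

Lemma loc_frac_sum (I : Type) (r : seq I) (a : I -> R) (s : R) (Ss : s \in S) :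
  \sum_(i <- r) loc_frac S (a i) s Ss = loc_frac S (\sum_(i <- r) a i) s Ss.
Proof.
elim: r => [|i r IH]; first by rewrite !big_nil loc_frac0.
by rewrite !big_cons IH loc_fracDl.
Qed.

Lemma loc_trivial (x : localization S) : 0 \in S -> x = 0.
Proof.
move=> S0; elim/loc_fracW: x => a s Ss.
by apply/loc_frac_eq0; exists 0; rewrite ?mul0r.
Qed.

(** The aliases [nontrivial] make polynomials available on both sides. *)
Definition loc_map (R1 : (1 : R) != 0) (L1 : (1 : localization S) != 0)
    (a : nontrivial R1) : nontrivial L1 := loc_frac S a 1 (rpred1 S).

End Fractions.

(** * The canonical map as a ring morphism *)

Section LocMap.
Variables (R : comPzRingType) (S : mulrClosed R).
Variables (R1 : (1 : R) != 0) (L1 : (1 : localization S) != 0).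

Fact loc_map_is_zmod_morphism : zmod_morphism (@loc_map R S R1 L1).
Proof. by move=> a b; rewrite /loc_map [in RHS]loc_fracN loc_fracDl. Qed.

Fact loc_map_is_monoid_morphism : monoid_morphism (@loc_map R S R1 L1).
Proof.
split=> // a b; rewrite /loc_map [RHS]loc_fracM; apply: loc_frac_eq.
by rewrite !mulr1.
Qed.

HB.instance Definition _ := GRing.isZmodMorphism.Build
  (nontrivial R1) (nontrivial L1) (@loc_map R S R1 L1) loc_map_is_zmod_morphism.
HB.instance Definition _ := GRing.isMonoidMorphism.Build
  (nontrivial R1) (nontrivial L1) (@loc_map R S R1 L1)
  loc_map_is_monoid_morphism.

End LocMap.

(** * The gradation of the localization *)

Section Gradation.
Variables (G : groupType) (R : comPzRingType) (R_ : G -> set R).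
Variable S : mulrClosed R.
Hypothesis gR : gradation R_.
Hypothesis hS : forall s, s \in S -> homogeneous R_ s.

Local Notation L_ := (@loc_gradation G R R_ S).

(** Freeness applies to the vanishing sum of [a] in degree [g] and [- a] in degree [h]. *)
Lemma homogeneous_degree_uniq g h a : R_ g a -> R_ h a -> a != 0 -> g = h.
Proof.
move=> ag ah a0; apply: contraNeq a0 => gh; apply/eqP.
pose f k := if k == g then a else if k == h then - a else 0.
have := @gradation_free _ _ _ gR [:: g; h] f.
rewrite /= inE gh /= !big_cons big_nil /f eqxx [h == g]eq_sym (negbTE gh) eqxx.
rewrite addr0 subrr => /(_ isT) H.
have /(_ _ erefl g) := H; rewrite eqxx mem_head; apply=> // k.
case: eqP => [->//|_]; case: eqP => [->|_]; last exact: (gradation0 gR).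
by rewrite -sub0r; exact: (gradationB gR (gradation0 gR h) ah).
Qed.

(* [G] need not be abelian, but [R] is commutative. *)
Lemma homogeneous_degree_comm g h a b :
  R_ g a -> R_ h b -> a * b != 0 -> (g * h)%g = (h * g)%g.
Proof.
move=> ag bh ab0.
apply: (@homogeneous_degree_uniq _ _ (a * b)) => //.
  exact: (gradationM gR ag bh).
by rewrite mulrC; exact: (gradationM gR bh ag).
Qed.

(** Solving [g = ds^-1 * da] for [da] leaves the degree of the denominator as the only parameter. *)
Lemma loc_gradationP g x :
  L_ g x <-> exists a s (Ss : s \in S) d,
    [/\ R_ (d * g)%g a, R_ d s & x = loc_frac S a s Ss].
Proof.
split=> [[a [s [Ss [da [ds [ha hs -> ->]]]]]]|[a [s [Ss [d [ha hs ->]]]]]].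
  by exists a, s, Ss, ds; rewrite mulVKg.
by exists a, s, Ss, (d * g)%g, d; rewrite mulKg.
Qed.

Lemma loc_gradation0 g : L_ g 0.
Proof.
have [d _ hd] := hS (rpred1 S).
apply/loc_gradationP; exists 0, 1, (rpred1 S), d; split=> //.
exact: (gradation0 gR).
Qed.

(* The degrees of the numerators only match a common denominator because the
   degrees of the elements of [S] commute with one another. *)
Lemma loc_gradation_common_den (I : eqType) (r : seq I) (deg : I -> G)
    (x : I -> localization S) :
  (forall i, L_ (deg i) (x i)) ->
  exists s (Ss : s \in S) d (a : I -> R),
    [/\ R_ d s, forall i, R_ (d * deg i)%g (a i)
      & forall i, i \in r -> x i = loc_frac S (a i) s Ss].
Proof.
move=> hx; elim: r => [|i0 r [s [Ss [d [a [hs ha e]]]]]].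
  have [d _ hd] := hS (rpred1 S).
  exists 1, (rpred1 S), d, (fun=> 0); split=> // i; exact: (gradation0 gR).
have /loc_gradationP[b [t [St [d' [hb ht e0]]]]] := hx i0.
(* The degrees of [s] and [t] are known to commute only if [s * t] is nonzero; when [0 \in S], all
   fractions vanish instead. *)
have [S0|S0] := boolP (0 \in S).
  exists s, Ss, d, (fun=> 0); split=> // i; first exact: (gradation0 gR).
  by rewrite [LHS]loc_trivial ?[RHS]loc_trivial.
have dd' : (d * d')%g = (d' * d)%g.
  apply: homogeneous_degree_comm hs ht _.
  by apply: contraNneq S0 => <-; apply: rpredM.
exists (s * t), (rpredM Ss St), (d * d')%g.
exists (fun i => if i == i0 then s * b else t * a i); split=> [|i|i].
- exact: (gradationM gR hs ht).
- case: eqP => [->|_].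
    by rewrite -mulgA; exact: (gradationM gR hs hb).
  by rewrite dd' -mulgA; exact: (gradationM gR ht (ha i)).
rewrite inE; case: eqP => [-> _|_ /= /e ->].
  by rewrite e0; apply: loc_frac_eq; ring.
by apply: loc_frac_eq; ring.
Qed.

Lemma loc_gradationB g x y : L_ g x -> L_ g y -> L_ g (x - y).
Proof.
move=> hx hy; pose z b := if b then x else y.
have [|s [Ss [d [a [hs ha e]]]]] :=
  @loc_gradation_common_den bool [:: true; false] (fun=> g) z; first by case.
apply/loc_gradationP; exists (a true - a false), s, Ss, d; split=> //.
  exact: (gradationB gR (ha true) (ha false)).
by rewrite -[x]/(z true) -[y]/(z false) !e // loc_fracN loc_fracDl.
Qed.

Lemma loc_gradationM g h x y : L_ g x -> L_ h y -> L_ (g * h)%g (x * y).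
Proof.
move=> /loc_gradationP[a [s [Ss [d [ha hs ->]]]]].
move=> /loc_gradationP[b [t [St [d' [hb ht ->]]]]].
(* If this product vanishes, [t * s] kills [a] and [a / s] is zero. Otherwise [s * t] and [a * t]
   are nonzero and their degrees commute. *)
have [ast0|ast0] := eqVneq (t * (s * a)) 0.
  have -> : loc_frac S a s Ss = 0.
    by apply/loc_frac_eq0; exists (t * s); rewrite ?rpredM // -mulrA.
  by rewrite mul0r; apply: loc_gradation0.
have dd' : (d * d')%g = (d' * d)%g.
  apply: homogeneous_degree_comm hs ht _.
  by apply: contraNneq ast0 => st; rewrite mulrCA mulrA st mul0r.
have dgd' : (d * g * d')%g = (d' * (d * g))%g.
  apply: homogeneous_degree_comm ha ht _.
  by apply: contraNneq ast0 => e; rewrite mulrCA [t * a]mulrC e mulr0.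
apply/loc_gradationP; exists (a * b), (s * t), (rpredM Ss St), (d * d')%g.
split; last exact: loc_fracM; last exact: (gradationM gR hs ht).
(* Both sides equal [d' * d * g * h], as [d'] commutes with [d] and with [d * g]. *)
suff -> : (d * d' * (g * h) = (d * g) * (d' * h))%g.
  exact: (gradationM gR ha hb).
by rewrite !mulgA dgd' dd' !mulgA.
Qed.

Lemma loc_gradation_span x : exists (r : seq G) (f : G -> localization S),
  [/\ uniq r, forall g, L_ g (f g) & x = \sum_(g <- r) f g].
Proof.
elim/loc_fracW: x => a s Ss.
have [d _ hd] := hS Ss.
have [r [f [Ur hf ->]]] := gradation_span gR a.
(* Dividing by [s], of degree [d], translates every degree by [d^-1]. *)
exists (map (fun g => d^-1 * g)%g r).
exists (fun g => loc_frac S (f (d * g)%g) s Ss); split.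
- by rewrite map_inj_uniq //; exact: mulgI.
- by move=> g; apply/loc_gradationP; exists (f (d * g)%g), s, Ss, d.
rewrite big_map -loc_frac_sum; apply: eq_bigr => g _.
by rewrite mulVKg.
Qed.

Lemma loc_gradation_free (r : seq G) (f : G -> localization S) :
  uniq r -> (forall g, L_ g (f g)) -> \sum_(g <- r) f g = 0 ->
  forall g, g \in r -> f g = 0.
Proof.
move=> Ur hf.
have [s [Ss [d [a [hs ha e]]]]] := @loc_gradation_common_den G r id f hf.
rewrite (eq_big_seq _ e) loc_frac_sum => /loc_frac_eq0[u Su eu] g gr.
rewrite e //; apply/loc_frac_eq0; exists u => //.
have [d' _ hu] := hS Su.
(* [F] indexes the terms [u * a k] by their degree [d' * (d * k)] in [R], so that freeness in [R]
   applies. *)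
pose F k := u * a (d^-1 * (d'^-1 * k))%g.
have FE k : F (d' * (d * k))%g = u * a k by rewrite /F !mulKg.
rewrite -FE; apply: (@gradation_free _ _ _ gR
  (map (fun k => d' * (d * k))%g r) F).
- by rewrite map_inj_uniq // => k1 k2 /mulgI/mulgI.
- move=> k; rewrite -{1}(mulVKg d' k) -{1}(mulVKg d (d'^-1 * k)%g).
  exact: (gradationM gR hu (ha _)).
- by rewrite big_map -[RHS]eu mulr_sumr; apply: eq_bigr => k _; rewrite FE.
by apply: map_f.
Qed.

Lemma loc_gradation_gradation : gradation L_.
Proof.
split.
- exact: loc_gradation0.
- exact: loc_gradationB.
- exact: loc_gradation_span.
- exact: loc_gradation_free.
- exact: loc_gradationM.
Qed.

(** A common denominator of degree [d] puts all numerators in degree [d * g], so [p] is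
    homogeneous. *)
Lemma loc_homogeneous_poly_clear_den (R1 : (1 : R) != 0)
    (L1 : (1 : localization S) != 0) (f : {poly nontrivial L1}) :
  homogeneous (@poly_gradation G (nontrivial L1) L_) f ->
  exists (s : nontrivial R1) (p : {poly nontrivial R1}),
    [/\ s \in S, homogeneous (@poly_gradation G (nontrivial R1) R_) p
      & (loc_map L1 s)%:P * f = map_poly (@loc_map R S R1 L1) p].
Proof.
move=> [g _ hf].
have [s [Ss [d [a [hs ha e]]]]] :=
  @loc_gradation_common_den nat (iota 0 (size f)) (fun=> g) _ hf.
exists s, (\poly_(i < size f) (a i : nontrivial R1)); split=> //.
  exists (d * g)%g => // i; rewrite coef_poly; case: ifP => _ //.
  exact: (gradation0 gR).
apply/polyP=> i; rewrite coefCM coef_map coef_poly.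
case: ltnP => i_f; last first.
  rewrite nth_default // mulr0; exact: esym (rmorph0 (@loc_map R S R1 L1)).
rewrite e ?mem_iota // /loc_map [LHS]loc_fracM.
by apply: loc_frac_eq; rewrite !mulr1 mul1r mulrC.
Qed.

End Gradation.

(** * The EM condition over the localization *)

Theorem theorem3p13 (G : groupType) (R : comPzRingType) (R_ : G -> set R)
    (S : mulrClosed R) (hR : EM_graded R_)
    (hS : forall s, s \in S -> homogeneous R_ s) :
  EM_graded (@loc_gradation G R R_ S).
Proof.
have [gR EM] := hR; split=> [|L1 f f0 hf zf].
  exact: loc_gradation_gradation.
(* The EM condition on [R] presupposes [1 != 0], which is inherited from [L1]. *)
have R1 : (1 : R) != 0.
  apply: (contraNneq _ L1) => R10; apply/eqP/loc_frac_eq0.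
  by exists 1; rewrite ?rpred1 // mul1r.
have [s [p [Ss hp e]]] := loc_homogeneous_poly_clear_den gR hS R1 hf.
(* It remains to check that [loc_map] is a localization map and to apply the EM condition to [p]. *)
apply: (@annihilating_content_descent (nontrivial R1) (nontrivial L1) S
  (@loc_map R S R1 L1) _ _ _ s p f Ss e f0 zf).
- move=> t St; exists (loc_frac S 1 t St); rewrite /loc_map [LHS]loc_fracM.
  by apply: loc_frac_eq; rewrite !mulr1 mul1r.
- elim/loc_fracW => a t St; exists a, t; split=> //.
  rewrite /loc_map [LHS]loc_fracM.
  by apply: loc_frac_eq; rewrite !mulr1 mul1r mulrC.
- by move=> a /loc_frac_eq0.
by move=> p0 zp; apply: EM.
Qed.
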